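(* Let $\alpha\in(0,1)$, let $g:\mathbb{R}^n\to[0,\infty)$ satisfy $g\in L^\infty_{loc}(\mathbb{R}^n)$ and $g(0)=0$, and let $m>0$. Suppose that, up to sets of measure zero, there is a unique minimizer $E_m$ of $\mathcal{E}$ among measurable subsets of $\mathbb{R}^n$ of measure $m$. Let $R=R(m)>0$ be a radius. Then for every $\epsilon>0$ there exists $w_m(\epsilon)>0$ such that whenever $E\subset B_R$ is measurable with $|E|=|E_m|=m$ and $$|\mathcal{E}(E)-\mathcal{E}(E_m)|<w_m(\epsilon),$$ one has $$\frac{\|\chi_E-\chi_{E_m}\|_{L^1}}{|E_m|}<\epsilon .$$
   Context: $B_R$ is the ball of radius $R$ in $\mathbb{R}^n$ centered at the origin, $|\cdot|$ applied to a set is Lebesgue measure, $\chi_E$ is the characteristic function of $E$. For measurable $E\subset\mathbb{R}^n$, $$P_\alpha(E)=\int_E\int_{E^c}\frac{1}{|x-y|^{n+\alpha}}\,dx\,dy,\qquad \mathcal{G}(E)=\int_E g(x)\,dx,\qquad \mathcal{E}(E)=P_\alpha(E)+\mathcal{G}(E).$$ A minimizer of mass $m$ is a measurable set $E_m$ with $|E_m|=m$ and $\mathcal{E}(E_m)=\inf\{\mathcal{E}(E):|E|=m\}$. *)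

(* Defs.v *)
From HB Require Import structures.
From mathcomp Require Import all_boot all_order all_algebra.
From mathcomp Require Import all_classical all_reals all_analysis.

Set Implicit Arguments.
Unset Strict Implicit.
Unset Printing Implicit Defensive.
Import Order.TTheory GRing.Theory Num.Theory.
Import numFieldNormedType.Exports.

Local Open Scope classical_set_scope.
Local Open Scope ring_scope.
Local Open Scope ereal_scope.

Section borel_lebesgue_cons.
Context (R : realType) (n : nat).
Notation RR := (measurableTypeR R).
Variable mu : {sigma_finite_measure set (n.-tuple RR) -> \bar R}.

Definition tcons (p : RR * n.-tuple RR) : n.+1.-tuple RR :=
  [tuple of p.1 :: p.2].

Lemma measurable_tcons : measurable_fun [set: RR * n.-tuple RR] tcons.
Proof. exact: measurable_cons. Qed.

Definition borel_lebesgue_cons : set (n.+1.-tuple RR) -> \bar R :=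
  pushforward (@lebesgue_measure R \x mu) tcons.

HB.instance Definition _ := Measure.copy borel_lebesgue_cons
  (measure_function_pushforward__canonical__measure_function_Measure
    (@lebesgue_measure R \x mu) measurable_tcons).

Lemma measurable_thead : measurable_fun [set: n.+1.-tuple RR] (@thead n RR).
Proof. exact: measurable_tnth. Qed.

Let sigma_finite_cons : sigma_finite setT borel_lebesgue_cons.
Proof.
have /sigma_finiteP[F [FT ndF Ffin]] := sigma_finiteT (@lebesgue_measure R).
have /sigma_finiteP[G [GT ndG Gfin]] := sigma_finiteT mu.
pose u (t : n.+1.-tuple RR) : RR * n.-tuple RR := (thead t, [tuple of behead t]).
have mu_ : measurable_fun setT u.
  by apply: measurable_fun_pair; [exact: measurable_thead | exact: measurable_behead].
have tconsK : cancel tcons u.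
  by case=> x t; rewrite /u /tcons theadE; congr pair; exact: val_inj.
have FGT : \bigcup_k (F k `*` G k) = setT.
  rewrite -setXTT FT GT predeqE => -[x y]; split.
    by move=> [k _ []/= ? ?]; split; exists k.
  move=> [/= [i _ Fx] [k _ Gy]]; exists (maxn i k) => //; split.
  - by move: x Fx; exact/subsetPset/ndF/leq_maxl.
  - by move: y Gy; exact/subsetPset/ndG/leq_maxr.
exists (fun k => u @^-1` (F k `*` G k)).
  by rewrite -preimage_bigcup FGT preimage_setT.
move=> k; have [mF finF] := Ffin k; have [mG finG] := Gfin k; split.
  by rewrite -[X in measurable X]setTI; apply: mu_ => //; exact: measurableX.
rewrite /borel_lebesgue_cons /pushforward.
have -> : tcons @^-1` (u @^-1` (F k `*` G k)) = F k `*` G k.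
  by rewrite -comp_preimage (_ : u \o tcons = id) //; apply/funext => p; exact: tconsK.
by rewrite product_measure1E// lte_mul_pinfty// ge0_fin_numE.
Qed.

HB.instance Definition _ :=
  Measure_isSigmaFinite.Build _ _ _ borel_lebesgue_cons sigma_finite_cons.

End borel_lebesgue_cons.

(* The n-fold product of the one-dimensional Lebesgue measure on the Borel sets
   of R^n, by recursion along R^(n+1) ~ R * R^n. *)
Fixpoint borel_lebesgue (R : realType) (n : nat) :
    {sigma_finite_measure set (n.-tuple (measurableTypeR R)) -> \bar R} :=
  if n is n'.+1 then borel_lebesgue_cons (borel_lebesgue R n')
  else \d_([tuple] : 0.-tuple (measurableTypeR R)).

Lemma borel_lebesgue_box (R : realType) (n : nat)
    (A : 'I_n -> set (measurableTypeR R)) :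
  (forall i, measurable (A i)) ->
  borel_lebesgue R n [set x | forall i, A i (tnth x i)] =
  \prod_(i < n) lebesgue_measure (A i).
Proof.
elim: n A => [|n IH] A mA.
  by rewrite big_ord0 /= diracE mem_set// => -[].
rewrite big_ord_recl -IH//= /borel_lebesgue_cons /pushforward.
have mB : measurable [set x : n.-tuple (measurableTypeR R) |
    forall i, A (lift ord0 i) (tnth x i)].
  rewrite (_ : [set _ | _] = \big[setI/setT]_(i < n)
      ((@tnth n (measurableTypeR R) ^~ i) @^-1` A (lift ord0 i))).
    apply: bigsetI_measurable => i _.
    by rewrite -[X in measurable X]setTI; exact: measurable_tnth.
  rewrite -bigcap_seq; apply/seteqP; split => x h i; first by move=> _; exact: h.
  exact: h (mem_index_enum i).
rewrite -product_measure1E//; congr (_ _).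
apply/seteqP; split => -[x t] /=.
  by move=> h; split; [exact: (h ord0) | move=> i; have := h (lift ord0 i); rewrite tnthS].
move=> [h0 h] i; case: (unliftP ord0 i) => [j|] ->; last exact: h0.
by rewrite tnthS; exact: h.
Qed.

(* R^n with the Lebesgue-measurable sets: the sigma-algebra is the completion of
   the Borel one, and the points are plain n-tuples of reals. *)
Definition Rn (R : realType) (n : nat) :
    measurableType ((borel_lebesgue R n)^*%mu).-cara :=
  caratheodory_type (borel_lebesgue R n)^*%mu.

Definition lebesgue (R : realType) (n : nat) : set (Rn R n) -> \bar R :=
  @completed_measure_extension _ _ _ (borel_lebesgue R n).

HB.instance Definition _ (R : realType) (n : nat) :=
  Measure.on (@lebesgue R n).

Lemma lebesgue_sigma_finite (R : realType) (n : nat) :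
  sigma_finite setT (@lebesgue R n).
Proof.
exact/completed_measure_extension_sigma_finite/sigma_finiteT.
Qed.

HB.instance Definition _ (R : realType) (n : nat) :=
  Measure_isSigmaFinite.Build _ _ _ (@lebesgue R n) (@lebesgue_sigma_finite R n).

Section energy.
Context (R : realType) (n : nat).
Notation mu := (@lebesgue R n).
Implicit Types (x y : Rn R n) (E F : set (Rn R n)) (g : Rn R n -> R).

Definition coord x (i : 'I_n) : R := tnth (x : n.-tuple R) i.

Definition origin : Rn R n := [tuple 0%R | i < n].

Definition edist x y : R := Num.sqrt (\sum_(i < n) (coord x i - coord y i) ^+ 2).

Definition eball (r : R) : set (Rn R n) := [set x | (edist x origin < r)%R].

(* the balls centered at the origin exhaust the compact subsets of R^n *)
Definition Linfty_loc g :=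
  measurable_fun setT g /\
  forall r : R, (0 < r)%R ->
    exists C : R, {ae mu, forall x, eball r x -> (`|g x| <= C)%R}.

Definition frac_perimeter (alpha : R) E : \bar R :=
  \int[mu]_(y in E) \int[mu]_(x in ~` E)
    ((edist x y `^ (n%:R + alpha))^-1)%:E.

Definition potential g E : \bar R := \int[mu]_(x in E) (g x)%:E.

Definition energy (alpha : R) g E : \bar R :=
  frac_perimeter alpha E + potential g E.

Definition is_minimizer (alpha : R) g (m : R) E :=
  [/\ measurable E, mu E = m%:E &
      energy alpha g E =
      ereal_inf [set energy alpha g F | F in
                   [set F | measurable F /\ mu F = m%:E]]].

End energy.

(* Main.v *)
Require Import Defs.
From HB Require Import structures.
From mathcomp Require Import all_boot all_order all_algebra.
From mathcomp Require Import all_classical all_reals all_analysis.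
From mathcomp Require Import ring lra measurable_realfun.

Set Implicit Arguments.
Unset Strict Implicit.
Unset Printing Implicit Defensive.
Import Order.TTheory GRing.Theory Num.Theory.
Import numFieldNormedType.Exports.

Local Open Scope classical_set_scope.
Local Open Scope ring_scope.
Local Open Scope ereal_scope.

(** If the conclusion failed for some [eps], there would be sets [E_k] of mass
    [m] in a fixed ball whose energies converge to the minimum and which stay
    at distance at least [eps * m] from [Em] in measure. The direct method
    rules this out: the [E_k] subconverge in measure to a set of mass [m], its
    energy is at most the minimum, hence it is a minimizer, and uniqueness
    identifies it with [Em] up to a null set.

    Compactness ([perimeter_totally_bounded]) comes from a grid of cubes of
    side [h] covering the ball. In a cube [Q] the kernel of the fractional
    perimeter is at least [(sqrt n * h) ^ -(n + alpha)], so the interaction of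
    [Q `&` E] with [Q `\` E] controls the product of their measures, and
    therefore, as these add up to [h ^ n], the smaller of the two. Summed over
    the grid, a perimeter bound [C] makes [E] agree with the union of the cubes
    of which it fills more than half up to a set of measure
    [2 * C * sqrt n ^ (n + alpha) * h ^ alpha]. There are finitely many unions
    of cubes, so finitely many classes, each of small diameter. Choosing
    classes along an ultrafilter gives a subsequence with jumps
    [mu (E_j `+` E_j.+1) <= 2 ^ -(j + 1)] ([diagonal_pigeonhole]).

    For such a subsequence the inferior limit [A] of the sets is also the limit
    in measure, by Borel-Cantelli ([measure_setY_liminf]), and the complement
    of [A] is, up to a null set, the inferior limit of the complements
    ([liminf_gap_null]). Both are increasing unions of tail intersections
    contained in [E_j], respectively in its complement, for all large [j], so
    the lower semicontinuity of the energy ([energy_liminf_le]) is two monotone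
    passages to the limit.

    When the minimal energy is infinite, the hypothesis on the energy gap cannot
    hold, since the difference of any energy with [+oo] is [-oo]. *)

(** * Inferior limits of sequences of sets with summable jumps *)

Section set_sequences.
Context (T : Type).
Implicit Types E : (set T)^nat.

Definition cap_tail E (J : nat) : set T := \bigcap_(j in [set j | (J <= j)%N]) E j.

Definition set_liminf E : set T := \bigcup_J cap_tail E J.

(** The exceptional set for the tail from [J] on: off it, membership in [E j] no
    longer depends on [j]. *)
Definition cup_jumps E (J : nat) : set T :=
  \bigcup_i (E (J + i)%N `+` E (J + i).+1).

Lemma cap_tail_homo E :
  {homo cap_tail E : J K / (J <= K)%N >-> (J <= K)%O}.
Proof.
move=> J K JK; apply/subsetPset => x h j /= Kj; apply: h => /=.
exact: leq_trans Kj.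
Qed.

Lemma cap_tail_sub E J j : (J <= j)%N -> cap_tail E J `<=` E j.
Proof. by move=> Jj x; apply. Qed.

Lemma no_jump_const E J x : ~ cup_jumps E J x ->
  forall j, (J <= j)%N -> E j x <-> E J x.
Proof.
move=> nx j /subnKC <-; elim: (j - J)%N => [|i IH]; first by rewrite addn0.
rewrite -IH addnS; split=> h; apply: contrapT => nh; apply: nx; exists i => //.
  by right.
by left.
Qed.

Lemma setY_liminf_sub E J : set_liminf E `+` E J `<=` cup_jumps E J.
Proof.
move=> x h; apply: contrapT => nx; have c := no_jump_const nx; case: h => -[].
  move=> [K _ EK] nE; apply: nE; apply: (proj1 (c (maxn J K) (leq_maxl _ _))).
  by apply: EK => /=; exact: leq_maxr.
by move=> EJ; apply; exists J => // j /= /c ->.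
Qed.

Lemma liminf_gap_sub E J :
  ~` set_liminf E `\` set_liminf (fun j => ~` E j) `<=` cup_jumps E J.
Proof.
move=> x [n1 n2]; apply: contrapT => nx; have c := no_jump_const nx.
have [EJ|EJ] := pselect (E J x).
  by apply: n1; exists J => // j /= /c ->.
by apply: n2; exists J => // j /= /c ->.
Qed.

End set_sequences.

Section measure_liminf.
Context d (T : measurableType d) (R : realType) (mu : {measure set T -> \bar R}).
Variable E : (set T)^nat.
Hypothesis mE : forall j, measurable (E j).

Lemma measurable_setY (A B : set T) :
  measurable A -> measurable B -> measurable (A `+` B).
Proof. by move=> mA mB; apply: measurableU; exact: measurableD. Qed.

Lemma measurable_cap_tail J : measurable (cap_tail E J).
Proof. by apply: bigcap_measurable => [|j _]; [exists J => /= | exact: mE]. Qed.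

Lemma measurable_set_liminf : measurable (set_liminf E).
Proof. by apply: bigcup_measurable => J _; exact: measurable_cap_tail. Qed.

Lemma measurable_cup_jumps J : measurable (cup_jumps E J).
Proof. by apply: bigcup_measurable => i _; exact: measurable_setY. Qed.

Hypothesis fastE :
  forall j, mu (E j `+` E j.+1) <= ((2 ^ j.+1)%:R^-1)%:E.

(** The geometric series of the jumps from the rank [J] on sums to [2 ^ -J]. *)
Lemma measure_cup_jumps J : mu (cup_jumps E J) <= ((2 ^ J)%:R^-1)%:E.
Proof.
apply: (@le_trans _ _ (\sum_(0 <= i <oo) mu (E (J + i)%N `+` E (J + i).+1))).
  apply: (measure_sigma_subadditive mu) => //.
  - by move=> i; exact: measurable_setY.
  - exact: measurable_cup_jumps.
apply: le_trans (epsilon_trick0 xpredT (_ : (0 <= (2 ^ J)%:R^-1)%R)) => //.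
apply: lee_nneseries => i // _; apply: le_trans (fastE _) _.
by rewrite lee_fin -addnS expnD natrM invfM.
Qed.

Lemma measure_setY_liminf J : mu (set_liminf E `+` E J) <= ((2 ^ J)%:R^-1)%:E.
Proof.
apply: le_trans (measure_cup_jumps J); apply: le_measure; rewrite ?inE.
- apply: measurable_setY => //; exact: measurable_set_liminf.
- exact: measurable_cup_jumps.
- exact: setY_liminf_sub.
Qed.

End measure_liminf.

Lemma exp2_small (R : realType) (e : R) : (0 < e)%R ->
  exists J : nat, ((2 ^ J)%:R^-1 < e)%R.
Proof.
move=> e0; exists (Num.truncn e^-1).+1.
rewrite invf_plt ?posrE ?ltr0n ?expn_gt0//.
apply: (@lt_le_trans _ _ (Num.truncn e^-1).+1%:R).
  by rewrite truncnS_gt.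
by rewrite ler_nat ltnW// ltn_expl.
Qed.

(** A point in neither inferior limit changes sides infinitely often, so it lies
    in [cup_jumps E J] for every [J]. *)
Lemma liminf_gap_null d (T : measurableType d) (R : realType)
    (mu : {measure set T -> \bar R}) (E : (set T)^nat) :
  (forall j, measurable (E j)) ->
  (forall j, mu (E j `+` E j.+1) <= ((2 ^ j.+1)%:R^-1)%:E) ->
  mu (~` set_liminf E `\` set_liminf (fun j => ~` E j)) = 0.
Proof.
move=> mE fE; apply/eqP; rewrite eq_le measure_ge0 andbT.
apply/lee_addgt0Pr => e /exp2_small[J Je]; rewrite add0e.
apply: (@le_trans _ _ (mu (cup_jumps E J))).
  apply: le_measure; rewrite ?inE.
  - apply: measurableD; first exact/measurableC/measurable_set_liminf.
    by apply: measurable_set_liminf => j; exact: measurableC.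
  - exact: measurable_cup_jumps.
  - exact: liminf_gap_sub.
by apply: le_trans (measure_cup_jumps _ _ _) _ => //; rewrite lee_fin ltW.
Qed.

Lemma measure_le_setY d (T : measurableType d) (R : realType)
    (mu : {measure set T -> \bar R}) (A B : set T) :
  measurable A -> measurable B -> mu A <= mu B + mu (A `+` B).
Proof.
move=> mA mB; have mY := measurable_setY mA mB.
apply: le_trans (measureU2 mu mB mY); apply: le_measure; rewrite ?inE//.
  exact: measurableU.
by move=> x Ax; have [?|?] := pselect (B x); [left|right; left].
Qed.

Lemma measure_liminf_eq d (T : measurableType d) (R : realType)
    (mu : {measure set T -> \bar R}) (E : (set T)^nat) (m : \bar R) :
  (forall j, measurable (E j)) ->
  (forall j, mu (E j `+` E j.+1) <= ((2 ^ j.+1)%:R^-1)%:E) ->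
  (forall j, mu (E j) = m) -> mu (set_liminf E) = m.
Proof.
move=> mE fE Em; have mA := measurable_set_liminf mE.
apply/eqP; rewrite eq_le; apply/andP; split; apply/lee_addgt0Pr => e /exp2_small[J Je].
  apply: le_trans (measure_le_setY mu mA (mE J)) _; rewrite Em leeD2l//.
  by apply: le_trans (measure_setY_liminf _ _ _) _ => //; rewrite lee_fin ltW.
rewrite -(Em J); apply: le_trans (measure_le_setY mu (mE J) mA) _; rewrite leeD2l//.
rewrite setYC.
by apply: le_trans (measure_setY_liminf _ _ _) _ => //; rewrite lee_fin ltW.
Qed.

Lemma measure_bigsetU_le d (T : measurableType d) (R : realType)
    (mu : {measure set T -> \bar R}) (I : Type) (s : seq I) (A : I -> set T) :
  (forall i, measurable (A i)) ->
  mu (\big[setU/set0]_(i <- s) A i) <= \sum_(i <- s) mu (A i).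
Proof.
move=> mA; elim: s => [|i s IH]; first by rewrite !big_nil measure0.
rewrite !big_cons; apply: le_trans (measureU2 _ _ _) _ => //.
  exact: bigsetU_measurable.
exact: leeD2l.
Qed.

(** Each row [c j] takes finitely many values, so along an ultrafilter finer than
    the Frechet filter it is constant on a large set. Any two large sets meet
    beyond any rank; this replaces the extraction of nested subsequences and
    a diagonal argument. *)
Lemma diagonal_pigeonhole (b : nat -> nat) (c : nat -> nat -> nat) :
  (forall j k, (c j k < b j)%N) ->
  exists phi : nat -> nat, forall j,
    (j <= phi j)%N /\ c j (phi j) = c j (phi j.+1).
Proof.
move=> cb; have [U [UU oU]] := ultraFilterLemma (eventually_filter).
have PU : ProperFilter U by exact: ultra_proper.
have /choice[v Uv] j : exists v, U [set k | c j k = v].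
  apply: contrapT => nU.
  have : U [set k | forall v : 'I_(b j), c j k != v].
    apply: filter_forall => v.
    case: (in_ultra_setVsetC [set k | c j k = v] UU) => [Uv|].
      by exfalso; apply: nU; exists v.
    by apply: filterS => k /= /eqP.
  move/filter_ex => [k /(_ (Ordinal (cb j k)))].
  by rewrite eqxx.
(* Asking for the limit value of the row [j.-1] too makes [phi j] and
   [phi j.+1] agree on the row [j]. *)
have /choice[phi phiP] j :
    exists k, [/\ (j <= k)%N, c j k = v j & c j.-1 k = v j.-1].
  have Uj : U [set k | (j <= k)%N] by apply: oU; exists j.
  have [k [[]]] := filter_ex (filterI (filterI Uj (Uv j)) (Uv j.-1)).
  by move=> *; exists k.
exists phi => j; have [le1 -> _] := phiP j; have [_ _ /= ->] := phiP j.+1.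
by [].
Qed.

(** * Lebesgue measure, distance and Riesz kernel *)

Section euclidean_space.
Context (R : realType) (n : nat).
Implicit Types (x y : Rn R n) (A B : set (Rn R n)).
Local Notation mu := (@lebesgue R n).

Lemma measurable_borel (A : set (n.-tuple (measurableTypeR R))) :
  measurable A -> measurable (A : set (Rn R n)).
Proof. exact: caratheodory_measurable_mu_ext. Qed.

Lemma lebesgue_borel (A : set (n.-tuple (measurableTypeR R))) :
  measurable A -> mu A = borel_lebesgue R n A.
Proof. exact: measurable_mu_extE. Qed.

Lemma measurable_coord (i : 'I_n) :
  measurable_fun setT (fun x : Rn R n => Defs.coord x i).
Proof.
move=> _ A mA; rewrite setTI; apply: measurable_borel.
by rewrite -[X in measurable X]setTI; exact: measurable_tnth.
Qed.

Lemma measurable_edist :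
  measurable_fun setT (fun p : Rn R n * Rn R n => Defs.edist p.1 p.2).
Proof.
apply: (measurableT_comp (f := @Num.sqrt R)).
  apply: continuous_measurable_fun.
  by move=> x; exact: sqrt_continuous.
apply: measurable_sum => i; apply: measurable_funX; apply: measurable_funB.
  exact: measurableT_comp (measurable_coord i) _.
exact: measurableT_comp (measurable_coord i) _.
Qed.

Lemma edist_gt0 x y : x <> y -> (0 < Defs.edist x y)%R.
Proof.
move=> xy; rewrite sqrtr_gt0 lt_neqAle sumr_ge0 ?andbT; last first.
  by move=> i _; exact: sqr_ge0.
apply/eqP => /esym/eqP; rewrite psumr_eq0; last by move=> i _; exact: sqr_ge0.
move=> /allP h; apply: xy; apply: eq_from_tnth => i.
by have := h i (mem_index_enum i); rewrite sqrf_eq0 subr_eq0 => /eqP.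
Qed.

Lemma abs_coord_le_edist x i : (`|Defs.coord x i| <= Defs.edist x (origin R n))%R.
Proof.
rewrite -sqrtr_sqr; apply: ler_wsqrtr; rewrite (bigD1 i)//=.
have -> : Defs.coord (origin R n) i = 0%R by exact: tnth_mktuple.
rewrite subr0 lerDl; apply: sumr_ge0 => j _.
exact: sqr_ge0.
Qed.

Section riesz_kernel.
Variable alpha : R.

(** The integrand of the fractional perimeter. On the diagonal its value is [0]
    instead of infinity, hence the hypotheses [x <> y] below. *)
Definition riesz x y : \bar R := ((Defs.edist x y `^ (n%:R + alpha))^-1)%:E.

Lemma riesz_ge0 x y : 0 <= riesz x y.
Proof. by rewrite lee_fin invr_ge0 powR_ge0. Qed.

Lemma measurable_riesz :
  measurable_fun setT (fun p : Rn R n * Rn R n => riesz p.1 p.2).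
Proof.
(* The inverse of a power is the opposite power, also at [0]. *)
apply/measurable_EFinP; under eq_fun do rewrite -powRN.
apply: (measurableT_comp (f := (@powR R)^~ _)) => //.
exact: measurable_edist.
Qed.

Lemma measurable_riesz1 y : measurable_fun setT (riesz ^~ y).
Proof.
have mp : measurable_fun setT (fun x : Rn R n => (x, y)).
  exact: measurable_fun_pair.
have := measurableT_comp measurable_riesz mp.
exact.
Qed.

(** Tonelli's theorem on the product of two copies of the completed Lebesgue
    sigma-algebra, for which the kernel is measurable since the coordinates are. *)
Lemma measurable_riesz_integral A : measurable A ->
  measurable_fun setT (fun y => \int[mu]_(x in A) riesz x y).
Proof.
move=> mA; pose f (p : Rn R n * Rn R n) := ((riesz ^~ p.1) \_ A) p.2.
have -> : (fun y => \int[mu]_(x in A) riesz x y) = fubini_F mu f.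
  by apply/funext => y; rewrite integral_mkcond.
apply: measurable_fun_fubini_tonelli_F; last first.
  by move=> p; rewrite /f; apply: erestrict_ge0 => *; exact: riesz_ge0.
have -> : f = (fun p : Rn R n * Rn R n => riesz p.2 p.1) \_ (setT `*` A).
  apply/funext => -[y x]; rewrite /f /patch /=.
  by congr (if _ then _ else _); apply/idP/idP; rewrite !inE//= => -[].
apply: (proj1 (measurable_restrictT _ (measurableX measurableT mA))).
apply: measurable_funTS.
have := measurableT_comp measurable_riesz
  (@measurable_swap _ _ (Rn R n) (Rn R n)).
exact.
Qed.

End riesz_kernel.

(** * The grid of cubes covering a ball *)

Section grid.
Context (rad : R) (N : nat).
Hypotheses (rad0 : (0 < rad)%R) (N0 : (0 < N)%N).

Definition mesh : R := (2 * rad / N%:R)%R.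

(** Half-open sides, so that the cubes of the grid are pairwise disjoint. *)
Definition side (k : nat) : interval R :=
  `[(- rad + k%:R * mesh)%R, (- rad + k.+1%:R * mesh)%R[.

Definition cube (z : {ffun 'I_n -> 'I_N}) : set (Rn R n) :=
  [set x | forall i, [set` side (z i)] (Defs.coord x i)].

Lemma mesh_gt0 : (0 < mesh)%R.
Proof. by rewrite divr_gt0 ?mulr_gt0 ?ltr0n. Qed.

Lemma side_lt (k l : nat) (a : R) : a \in side k -> a \in side l -> (k <= l)%N.
Proof.
rewrite !in_itv/= => /andP[ka _] /andP[_ al].
have := le_lt_trans ka al; rewrite ltrD2l ltr_pM2r ?mesh_gt0//.
by rewrite ltr_nat.
Qed.

Lemma trivIset_cube : trivIset setT cube.
Proof.
move=> z w _ _ [x [zx wx]]; apply/ffunP => i; apply: val_inj; apply/eqP.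
by rewrite eqn_leq (side_lt (zx i) (wx i)) (side_lt (wx i) (zx i)).
Qed.

Lemma measurable_cube_borel z :
  measurable (cube z : set (n.-tuple (measurableTypeR R))).
Proof.
rewrite (_ : cube z = \big[setI/setT]_(i < n)
    ((@tnth n (measurableTypeR R) ^~ i) @^-1` [set` side (z i)])).
  apply: bigsetI_measurable => i _; rewrite -[X in measurable X]setTI.
  exact: measurable_tnth.
rewrite -bigcap_seq; apply/seteqP; split => x h i; first by move=> _; exact: h.
exact: h (mem_index_enum i).
Qed.

Lemma measurable_cube z : measurable (cube z).
Proof. exact: measurable_borel (measurable_cube_borel z). Qed.

Lemma lebesgue_cube z : mu (cube z) = (mesh ^+ n)%:E.
Proof.
rewrite (lebesgue_borel (measurable_cube_borel z)).
rewrite (borel_lebesgue_box (A := fun i => [set` side (z i)]))//.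
rewrite (eq_bigr (fun=> mesh%:E)); last first.
  move=> i _; rewrite lebesgue_measure_itv/= lte_fin ltrD2l ltr_pM2r ?mesh_gt0//.
  rewrite ltr_nat ltnSn -EFinD; congr EFin.
  by rewrite opprD addrACA subrr add0r -mulrBl -natrB// subSnn mul1r.
by rewrite prodEFin prodr_const card_ord.
Qed.

Lemma side_cover (a : R) : (`|a| < rad)%R -> exists k : 'I_N, a \in side k.
Proof.
rewrite ltr_norml => /andP[a1 a2]; set t := ((a + rad) / mesh)%R.
have ra0 : (0 <= a + rad)%R by rewrite -lerBlDr sub0r ltW.
have t0 : (0 <= t)%R by rewrite divr_ge0// ltW// mesh_gt0.
have /andP[t1 t2] := truncn_itv t0.
have tN : (t < N%:R)%R.
  rewrite ltr_pdivrMr ?mesh_gt0// mulrC divfK ?pnatr_eq0 -?lt0n//.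
  by rewrite mulr_natl mulr2n ltrD2r.
have kN : (Num.truncn t < N)%N by rewrite -(ltr_nat R) (le_lt_trans t1).
have e1 : ((Num.truncn t)%:R * mesh <= a + rad)%R.
  by rewrite -ler_pdivlMr ?mesh_gt0.
have e2 : (a + rad < (Num.truncn t).+1%:R * mesh)%R.
  by rewrite -ltr_pdivrMr ?mesh_gt0.
by exists (Ordinal kN); rewrite in_itv/=; apply/andP; split; lra.
Qed.

Lemma eball_sub_cubes : eball rad `<=` \big[setU/set0]_z cube z.
Proof.
move=> x xr; have /choice[z zP] i : exists k : 'I_N, Defs.coord x i \in side k.
  by apply: side_cover; exact: le_lt_trans (abs_coord_le_edist x i) xr.
rewrite -bigcup_seq; exists [ffun i => z i]; first exact: mem_index_enum.
by move=> i; rewrite ffunE; exact: zP.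
Qed.

Lemma edist_cube z x y : cube z x -> cube z y ->
  (Defs.edist x y <= Num.sqrt n%:R * mesh)%R.
Proof.
move=> zx zy; have m0 := ltW mesh_gt0.
rewrite -[leRHS]ger0_norm; last by rewrite mulr_ge0// sqrtr_ge0.
rewrite -sqrtr_sqr; apply: ler_wsqrtr; rewrite exprMn sqr_sqrtr//.
apply: (@le_trans _ _ (\sum_(i < n) mesh ^+ 2)%R); last first.
  by rewrite sumr_const card_ord mulr_natl.
apply: ler_sum => i _; rewrite -real_normK ?num_real// lerXn2r ?nnegrE//.
move: (zx i) (zy i); rewrite /= !in_itv/= => /andP[x1 x2] /andP[y1 y2].
rewrite -natr1 mulrDl mul1r in x2 y2.
by rewrite ler_norml; apply/andP; split; lra.
Qed.

End grid.

End euclidean_space.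

(** * Compactness of sets of bounded perimeter in a ball *)

Section rounding.
Context (R : realType) (n : nat) (rad : R) (N : nat) (alpha : R).
Hypotheses (rad0 : (0 < rad)%R) (N0 : (0 < N)%N) (n0 : (0 < n)%N).
Hypothesis (alpha0 : (0 < alpha)%R).
Implicit Types (E F : set (Rn R n)) (z : {ffun 'I_n -> 'I_N}).
Local Notation mu := (@lebesgue R n).
Local Notation cube := (@cube R n rad N).
Local Notation mesh := (mesh rad N).

Let mesh0 : (0 < mesh)%R := mesh_gt0 rad0 N0.

Definition cube_diam : R := (Num.sqrt n%:R * mesh)%R.

(** How far [E] is, inside the cube, from being empty or full. *)
Definition minority E z : \bar R :=
  Order.min (mu (cube z `&` E)) (mu (cube z `\` E)).

Lemma riesz_ge_cube_diam z (x y : Rn R n) : cube z x -> cube z y -> x <> y ->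
  ((cube_diam `^ (n%:R + alpha))^-1)%:E <= riesz alpha x y.
Proof.
move=> zx zy xy; have d0 := edist_gt0 xy.
have dd := edist_cube rad0 N0 zx zy.
rewrite lee_fin lef_pV2 ?posrE ?powR_gt0//; last exact: lt_le_trans d0 dd.
have d1 := ltW d0; apply: ge0_ler_powR => //; last by rewrite nnegrE (le_trans d1).
by rewrite addr_ge0// ltW.
Qed.

(** The kernel is bounded below on the cube, so the interaction dominates the
    product [a * b] of the measures of the two parts; since [a + b] is the
    measure of the cube, [(a + b) * min a b <= 2 * a * b]. *)
Lemma minority_le_interaction E z : measurable E ->
  ((cube_diam `^ (n%:R + alpha))^-1 * mesh ^+ n)%:E * minority E z <=
  2%:E * \int[mu]_(y in cube z `&` E) \int[mu]_(x in ~` E) riesz alpha x y.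
Proof.
move=> mE; have mQ := measurable_cube rad z.
have mQE : measurable (cube z `&` E) by exact: measurableI.
have mQD : measurable (cube z `\` E) by exact: measurableD.
set c := (_^-1)%R.
have c0 : (0 <= c)%R by rewrite invr_ge0 powR_ge0.
have inner y : (cube z `&` E) y ->
    c%:E * mu (cube z `\` E) <= \int[mu]_(x in ~` E) riesz alpha x y.
  move=> [zy Ey]; apply: (@le_trans _ _ (\int[mu]_(x in cube z `\` E) riesz alpha x y)).
    rewrite -(integral_cst mu mQD c%:E); apply: ge0_le_integral.
    - exact: mQD.
    - by move=> x _; rewrite lee_fin.
    - exact: measurable_cst.
    - exact: measurable_funTS (measurable_riesz1 _ _).
    - move=> x [zx nEx]; apply: riesz_ge_cube_diam zx zy _ => xy.
      by apply: nEx; rewrite xy.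
  apply: ge0_subset_integral.
  - exact: mQD.
  - exact: measurableC.
  - exact: measurable_funTS (measurable_riesz1 _ _).
  - by move=> x _; exact: riesz_ge0.
  - by move=> x [].
have outer : c%:E * mu (cube z `\` E) * mu (cube z `&` E) <=
    \int[mu]_(y in cube z `&` E) \int[mu]_(x in ~` E) riesz alpha x y.
  rewrite -(integral_cst mu mQE (c%:E * mu (cube z `\` E))); apply: ge0_le_integral.
  - exact: mQE.
  - by move=> y _; rewrite mule_ge0// lee_fin.
  - exact: measurable_cst.
  - apply: measurable_funTS; apply: measurable_riesz_integral.
    exact: measurableC.
  - exact: inner.
apply: le_trans (lee_wpmul2l _ outer); last by rewrite lee_fin.
have muQ : mu (cube z `&` E) + mu (cube z `\` E) = (mesh ^+ n)%:E.
  by rewrite -(lebesgue_cube rad0 N0 z) [in RHS](measureDI mu mQ mE) addeC.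
have intg0 : 0 <= mu (cube z `&` E) by exact: measure_ge0.
have diff0 : 0 <= mu (cube z `\` E) by exact: measure_ge0.
rewrite /minority; move: muQ intg0 diff0.
move: (mu (cube z `&` E)) (mu (cube z `\` E)) => [a| |] [b| |] //= [<-].
rewrite (lee_fin 0%R a) (lee_fin 0%R b) => a0 b0.
rewrite -EFin_min -!EFinM lee_fin.
rewrite [leRHS](_ : _ = (c * (2 * (a * b)))%R); last by ring.
rewrite -mulrA ler_wpM2l//.
by have [ab|ba] := leP a b; nra.
Qed.

(** Only the outer variable is confined to the cube: the terms are integrals of
    one nonnegative function over disjoint parts of [E]. *)
Lemma sum_interaction_le E : measurable E ->
  \sum_z \int[mu]_(y in cube z `&` E) \int[mu]_(x in ~` E) riesz alpha x y <=
  frac_perimeter alpha E.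
Proof.
move=> mE; have mEC := measurableC mE.
have mQE z : measurable (cube z `&` E).
  by apply: measurableI => //; exact: measurable_cube.
have mh D : measurable_fun D (fun y => \int[mu]_(x in ~` E) riesz alpha x y).
  by apply: measurable_funTS; exact: measurable_riesz_integral.
have h0 y : 0 <= \int[mu]_(x in ~` E) riesz alpha x y.
  by apply: integral_ge0 => x _; exact: riesz_ge0.
rewrite -ge0_integral_bigsetU//=.
- apply: ge0_subset_integral.
  + by apply: bigsetU_measurable => z _; exact: mQE.
  + exact: mE.
  + exact: mh.
  + by move=> y _; exact: h0.
  + by rewrite -bigcup_seq => y [z _ []].
- exact: index_enum_uniq.
- apply: (@sub_trivIset _ _ _ setT) => //.
  by apply: trivIset_setIr; exact: trivIset_cube.
Qed.

Lemma sum_minority_le E (C : R) : measurable E ->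
  frac_perimeter alpha E <= C%:E ->
  \sum_z minority E z <=
  (2 * C * Num.sqrt n%:R `^ (n%:R + alpha) * mesh `^ alpha)%:E.
Proof.
move=> mE PC; set p := (n%:R + alpha)%R.
have s0 : (0 < Num.sqrt n%:R :> R)%R by rewrite sqrtr_gt0 ltr0n.
have d0 : (0 < cube_diam)%R by rewrite mulr_gt0.
set k := ((cube_diam `^ p)^-1 * mesh ^+ n)%R.
have k0 : (0 < k)%R by rewrite mulr_gt0 ?invr_gt0 ?powR_gt0 ?exprn_gt0.
have mp : (mesh `^ p = mesh ^+ n * mesh `^ alpha)%R.
  by rewrite powRD ?(gt_eqF mesh0) ?implybT// powR_mulrn ?(ltW mesh0).
(* The factors [mesh ^ n] of the cube and of the kernel cancel; the power
   [mesh ^ alpha] that survives is what makes the bound small. *)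
have -> : (2 * C * Num.sqrt n%:R `^ p * mesh `^ alpha = k^-1 * (2 * C))%R.
  rewrite /k invfM invrK /cube_diam (powRM _ (sqrtr_ge0 _) (ltW mesh0)) mp.
  have := exprn_gt0 n mesh0; move/lt0r_neq0 => hm; field; exact: hm.
rewrite EFinM -lee_pdivrMl ?invr_gt0// invrK ge0_sume_distrr; last first.
  by move=> z _; rewrite le_min !measure_ge0.
apply: (@le_trans _ _ (\sum_z 2%:E *
    \int[mu]_(y in cube z `&` E) \int[mu]_(x in ~` E) riesz alpha x y)).
  by apply: lee_sum => z _; exact: minority_le_interaction.
rewrite -ge0_sume_distrr; last first.
  move=> z _; apply: integral_ge0 => y _; apply: integral_ge0 => x _.
  exact: riesz_ge0.
rewrite EFinM; apply: lee_wpmul2l; first by rewrite lee_fin.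
exact: le_trans (sum_interaction_le mE) PC.
Qed.

(** Selects the cubes that [E] fills at most half, so that the union of the other
    cubes is the approximation of [E] on the grid. *)
Definition rounding E : {ffun {ffun 'I_n -> 'I_N} -> bool} :=
  [ffun z => mu (cube z `&` E) <= mu (cube z `\` E)].

Lemma minorityE E z :
  minority E z = mu (if rounding E z then cube z `&` E else cube z `\` E).
Proof. by rewrite ffunE /minority; case: leP. Qed.

(** If both sets are in the minority in the cube, a point of the difference lies
    in one of them; otherwise it lies in the complement of one of them. *)
Lemma cube_setY_le E F z : measurable E -> measurable F ->
  rounding E = rounding F ->
  mu (cube z `&` (E `+` F)) <= minority E z + minority F z.
Proof.
move=> mE mF EF; rewrite !minorityE EF.
have mQ := measurable_cube rad z.
have mY := measurableI _ _ mQ (measurable_setY mE mF).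
have bound A B : measurable A -> measurable B ->
    cube z `&` (E `+` F) `<=` A `|` B ->
    mu (cube z `&` (E `+` F)) <= mu A + mu B.
  move=> mA mB YAB; apply: le_trans (measureU2 mu mA mB).
  apply: le_measure => //; rewrite inE//; exact: measurableU.
case: (rounding F z); apply: bound.
- exact: measurableI.
- exact: measurableI.
- by move=> x [zx [[]|[]]]; [left | right].
- exact: measurableD.
- exact: measurableD.
- by move=> x [zx [[]|[]]]; [right | left].
Qed.

Lemma same_rounding_close E F (C : R) : measurable E -> measurable F ->
  E `<=` eball rad -> F `<=` eball rad ->
  frac_perimeter alpha E <= C%:E -> frac_perimeter alpha F <= C%:E ->
  rounding E = rounding F ->
  mu (E `+` F) <=
  (4 * C * Num.sqrt n%:R `^ (n%:R + alpha) * mesh `^ alpha)%:E.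
Proof.
move=> mE mF EB FB PE PF EF; have mY := measurable_setY mE mF.
have mQY z : measurable (cube z `&` (E `+` F)).
  exact: measurableI (measurable_cube _ _) mY.
apply: (@le_trans _ _ (\sum_z mu (cube z `&` (E `+` F)))).
  apply: le_trans (measure_bigsetU_le mu _ mQY).
  apply: le_measure; rewrite ?inE//; first exact: bigsetU_measurable.
  move=> x Yx; have xB : eball rad x by case: Yx => -[]; [move/EB | move/FB].
  have := eball_sub_cubes rad0 N0 xB; rewrite -!bigcup_seq => -[z zi zx].
  by exists z.
apply: (@le_trans _ _ (\sum_z (minority E z + minority F z))).
  by apply: lee_sum => z _; exact: cube_setY_le.
rewrite big_split/=; apply: le_trans (leeD (sum_minority_le mE PE) (sum_minority_le mF PF)) _.
by rewrite -EFinD lee_fin le_eqVlt; apply/orP; left; apply/eqP; ring.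
Qed.

End rounding.

Lemma powR_small (R : realType) (K a e : R) : (0 < a)%R -> (0 < e)%R ->
  (0 <= K)%R -> exists2 t : R, (0 < t)%R & (K * t `^ a <= e)%R.
Proof.
move=> a0 e0 K0; have K1 : (0 < K + 1)%R by rewrite ltr_wpDl.
exists ((e / (K + 1)) `^ a^-1)%R; first by rewrite powR_gt0// divr_gt0.
rewrite -powRrM mulVf ?gt_eqF// (powRr1 (ltW (divr_gt0 e0 K1))).
by rewrite mulrCA ger_pMr// ler_pdivrMr// mul1r lerDl.
Qed.

(** Total boundedness for the distance [lebesgue (E `+` F)], stated with a
    classifying function with finitely many values instead of a finite net,
    which is the form a pigeonhole argument uses. *)
Lemma perimeter_totally_bounded (R : realType) (n : nat) (alpha rad C eta : R) :
  (0 < n)%N -> (0 < alpha)%R -> (0 < rad)%R -> (0 <= C)%R -> (0 < eta)%R ->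
  exists bc : nat * (set (Rn R n) -> nat),
    (forall E, (bc.2 E < bc.1)%N) /\
    forall E F : set (Rn R n), measurable E -> measurable F ->
      E `<=` eball rad -> F `<=` eball rad ->
      frac_perimeter alpha E <= C%:E -> frac_perimeter alpha F <= C%:E ->
      bc.2 E = bc.2 F -> lebesgue (E `+` F) <= eta%:E.
Proof.
move=> n0 a0 rad0 C0 eta0.
pose K := (4 * C * Num.sqrt n%:R `^ (n%:R + alpha))%R.
have K0 : (0 <= K)%R by rewrite !mulr_ge0// powR_ge0.
have [t t0 Kt] := powR_small a0 eta0 K0.
pose N := (Num.truncn (2 * rad / t)).+1; have N0 : (0 < N)%N by [].
have mt : (mesh rad N <= t)%R.
  rewrite /mesh ler_pdivrMr ?ltr0n// [leRHS]mulrC -ler_pdivrMr//.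
  exact/ltW/truncnS_gt.
pose I : finType := {ffun {ffun 'I_n -> 'I_N} -> bool}.
exists (#|I|, fun E => nat_of_ord (enum_rank (rounding rad N E : I))); split=> [E|/=].
  exact: ltn_ord.
move=> E F mE mF EB FB PE PF /ord_inj/enum_rank_inj EF.
apply: le_trans (same_rounding_close rad0 N0 n0 a0 mE mF EB FB PE PF EF) _.
rewrite lee_fin; apply: le_trans Kt; apply: ler_wpM2l => //.
apply: ge0_ler_powR => //; rewrite ?nnegrE ltW//; exact: mesh_gt0.
Qed.

(** * Lower semicontinuity of the energy *)

Lemma cvge_le_bound (R : realType) (u : (\bar R)^nat) (l e : \bar R) :
  u @ \oo --> l -> (forall k, u k <= e) -> l <= e.
Proof.
move=> ul ue; rewrite -(cvg_lim _ ul)//; apply: lime_le; first exact: cvgP ul.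
exact: nearW.
Qed.

Section energy_semicontinuity.
Context (R : realType) (n : nat) (alpha : R) (g : Rn R n -> R).
Hypotheses (g0 : forall x, (0 <= g x)%R) (mg : measurable_fun setT g).
Implicit Types (E F A B : set (Rn R n)).
Local Notation mu := (@lebesgue R n).

(** Adding the potential to the inner integral of the perimeter turns the energy
    into a single integral, increasing in the domain of each variable when the
    set and its complement are replaced by independent sets. *)
Definition pair_density B (y : Rn R n) : \bar R :=
  \int[mu]_(x in B) riesz alpha x y + (g y)%:E.

Lemma pair_density_ge0 B y : 0 <= pair_density B y.
Proof.
apply: adde_ge0; last by rewrite lee_fin.
by apply: integral_ge0 => x _; exact: riesz_ge0.
Qed.

Lemma measurable_pair_density B D :
  measurable B -> measurable_fun D (pair_density B).
Proof.
move=> mB; apply: emeasurable_funD.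
  by apply: measurable_funTS; exact: measurable_riesz_integral.
by apply/measurable_EFinP; exact: measurable_funTS.
Qed.

Lemma le_pair_density B B' y : measurable B -> measurable B' -> B `<=` B' ->
  pair_density B y <= pair_density B' y.
Proof.
move=> mB mB' BB'; apply: leeD2r; apply: ge0_subset_integral.
- exact: mB.
- exact: mB'.
- exact: measurable_funTS (measurable_riesz1 _ _).
- by move=> x _; exact: riesz_ge0.
- exact: BB'.
Qed.

Lemma energyE E : measurable E ->
  energy alpha g E = \int[mu]_(y in E) pair_density (~` E) y.
Proof.
move=> mE; apply/esym; apply: ge0_integralD.
- exact: mE.
- by move=> y _; apply: integral_ge0 => x _; exact: riesz_ge0.
- apply: measurable_funTS; apply: measurable_riesz_integral.
  exact: measurableC.
- by move=> y _; rewrite lee_fin.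
- by apply/measurable_EFinP; exact: measurable_funTS.
Qed.

Lemma cvg_pair_density (B : (set (Rn R n))^nat) y :
  (forall k, measurable (B k)) -> {homo B : j k / (j <= k)%N >-> (j <= k)%O} ->
  pair_density (B k) y @[k --> \oo] --> pair_density (\bigcup_k B k) y.
Proof.
move=> mB homoB; apply: cvgeD; last exact: cvg_cst.
  apply: ge0_adde_def; rewrite inE/= ?lee_fin//.
  by apply: integral_ge0 => x _; exact: riesz_ge0.
apply: ge0_nondecreasing_set_cvg_integral.
- exact: homoB.
- exact: mB.
- by move=> k; exact: measurable_funTS (measurable_riesz1 _ _).
- by move=> k x _; exact: riesz_ge0.
Qed.

(** Monotone convergence in the inner domain, then in the outer one. *)
Lemma integral_pair_density_bigcup_le (A B : (set (Rn R n))^nat) (e : \bar R) :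
  (forall j, measurable (A j)) -> (forall k, measurable (B k)) ->
  {homo A : j k / (j <= k)%N >-> (j <= k)%O} ->
  {homo B : j k / (j <= k)%N >-> (j <= k)%O} ->
  (forall j k, \int[mu]_(y in A j) pair_density (B k) y <= e) ->
  \int[mu]_(y in \bigcup_j A j) pair_density (\bigcup_k B k) y <= e.
Proof.
move=> mA mB homoA homoB ABe; have mUB := bigcupT_measurable B mB.
have inner j : \int[mu]_(y in A j) pair_density (\bigcup_k B k) y <= e.
  have cv : \int[mu]_(y in A j) pair_density (B k) y @[k --> \oo] -->
      \int[mu]_(y in A j) limn (fun k => pair_density (B k) y).
    apply: cvg_monotone_convergence.
    - exact: mA.
    - by move=> k; exact: measurable_pair_density.
    - by move=> k y _; exact: pair_density_ge0.
    - move=> y _ k l kl; apply: le_pair_density; [exact: mB | exact: mB |].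
      exact/subsetPset/homoB.
  have -> : \int[mu]_(y in A j) pair_density (\bigcup_k B k) y =
      \int[mu]_(y in A j) limn (fun k => pair_density (B k) y).
    apply: eq_integral => y _; apply/esym/cvg_lim => //.
    exact: cvg_pair_density.
  exact: cvge_le_bound cv (ABe j).
have cv : \int[mu]_(y in A j) pair_density (\bigcup_k B k) y @[j --> \oo] -->
    \int[mu]_(y in \bigcup_j A j) pair_density (\bigcup_k B k) y.
  apply: ge0_nondecreasing_set_cvg_integral.
  - exact: homoA.
  - exact: mA.
  - by move=> j; exact: measurable_pair_density.
  - by move=> j y _; exact: pair_density_ge0.
exact: cvge_le_bound cv inner.
Qed.

(** The two inferior limits exhaust the space up to a null set, so the energy of
    [set_liminf E] is the integral over both of them. Finite stages of these
    increasing unions are contained in [E l] and in its complement for a common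
    large [l]. *)
Lemma energy_liminf_le (E : (set (Rn R n))^nat) (e : \bar R) :
  (forall j, measurable (E j)) ->
  mu (~` set_liminf E `\` set_liminf (fun j => ~` E j)) = 0 ->
  (\forall j \near \oo, energy alpha g (E j) <= e) ->
  energy alpha g (set_liminf E) <= e.
Proof.
move=> mE gap0 [J _ Ee]; set A := set_liminf E.
set B := set_liminf (fun j => ~` E j).
have mEC j : measurable (~` E j) by exact: measurableC.
have mA : measurable A by exact: measurable_set_liminf.
have mB : measurable B by exact: measurable_set_liminf.
have BA : B `<=` ~` A.
  move=> x [j _ jB] [k _ kA].
  exact: (jB (maxn j k) (leq_maxl _ _)) (kA _ (leq_maxr _ _)).
have dens y : pair_density (~` A) y = pair_density B y.
  rewrite /pair_density; congr (_ + _).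
  rewrite -[in RHS](setIidr BA) -setDD; apply: ge0_negligible_integral.
  - by apply: measurableD mB; exact: measurableC.
  - exact: measurableC.
  - exact: measurable_funTS (measurable_riesz1 _ _).
  - by move=> x _; exact: riesz_ge0.
  - exact: gap0.
rewrite (energyE mA); under eq_integral do rewrite dens.
apply: integral_pair_density_bigcup_le.
- by move=> j; exact: measurable_cap_tail.
- by move=> j; exact: measurable_cap_tail.
- exact: cap_tail_homo.
- exact: cap_tail_homo.
move=> j k; pose l := maxn J (maxn j k).
have Jl : (J <= l)%N by exact: leq_maxl.
have jl : (j <= l)%N by rewrite /l maxnCA leq_maxl.
have kl : (k <= l)%N by rewrite /l maxnA leq_maxr.
apply: le_trans (Ee l Jl); rewrite (energyE (mE l)).
apply: (@le_trans _ _ (\int[mu]_(y in cap_tail E j) pair_density (~` E l) y)).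
  apply: ge0_le_integral.
  - exact: measurable_cap_tail.
  - by move=> y _; exact: pair_density_ge0.
  - by apply: measurable_pair_density; exact: measurable_cap_tail.
  - exact: measurable_pair_density.
  - move=> y _; apply: le_pair_density => //; first exact: measurable_cap_tail.
    exact: (cap_tail_sub (E := fun j => ~` E j) kl).
apply: ge0_subset_integral.
- exact: measurable_cap_tail.
- exact: mE.
- exact: measurable_pair_density.
- by move=> y _; exact: pair_density_ge0.
- exact: cap_tail_sub.
Qed.

End energy_semicontinuity.

Lemma setY_triangle d (T : measurableType d) (R : realType)
    (mu : {measure set T -> \bar R}) (A B C : set T) :
  measurable A -> measurable B -> measurable C ->
  mu (A `+` C) <= mu (A `+` B) + mu (B `+` C).
Proof.
move=> mA mB mC; have mAB := measurable_setY mA mB.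
have mBC := measurable_setY mB mC.
apply: le_trans (measureU2 mu mAB mBC); apply: le_measure; rewrite ?inE.
- exact: measurable_setY.
- exact: measurableU.
by move=> x; have [Bx|nBx] := pselect (B x); move=> [[]|[]] *;
  [right; left | left; right | left; left | right; right].
Qed.

Lemma Lnorm1_indicB d (T : measurableType d) (R : realType)
    (mu : {measure set T -> \bar R}) (A B : set T) :
  measurable A -> measurable B ->
  'N[mu]_1[EFin \o (\1_A \- \1_B)%R] = mu (A `+` B).
Proof.
move=> mA mB; have mY := measurable_setY mA mB.
rewrite Lnorm1 -[A `+` B]setIT -integral_indic//; apply: eq_integral => x _ /=.
rewrite !indicE; congr EFin.
have [Ax|Ax] := pselect (A x); have [Bx|Bx] := pselect (B x).
- rewrite (mem_set Ax) (mem_set Bx) subrr normr0 memNset//.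
  by case=> -[].
- by rewrite (mem_set Ax) (memNset Bx) subr0 normr1 mem_set//; left.
- by rewrite (memNset Ax) (mem_set Bx) sub0r normrN normr1 mem_set//; right.
- rewrite (memNset Ax) (memNset Bx) subrr normr0 memNset//.
  by case=> -[].
Qed.

(** * Stability of the minimizer *)

Theorem proposition3p1 (R : realType) (n : nat) (alpha : R) (g : Rn R n -> R)
    (m : R) (Em : set (Rn R n)) (rad : R)
    (hn : (0 < n)%N) (halpha : (0 < alpha < 1)%R)
    (hg_ge0 : forall x, (0 <= g x)%R) (hg_loc : Linfty_loc g)
    (hg0 : g (origin R n) = 0%R) (hm : (0 < m)%R)
    (hEm : is_minimizer alpha g m Em)
    (hEm_unique : forall F : set (Rn R n),
        is_minimizer alpha g m F -> lebesgue (F `+` Em) = 0)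
    (hrad : (0 < rad)%R) :
  forall eps : R, (0 < eps)%R ->
  exists2 w : R, (0 < w)%R &
    forall E : set (Rn R n),
      E `<=` eball rad -> measurable E ->
      lebesgue E = lebesgue Em ->
      `|energy alpha g E - energy alpha g Em| < w%:E ->
      'N[@lebesgue R n]_1[EFin \o (\1_E \- \1_Em)%R] / lebesgue Em < eps%:E.
Proof.
move=> eps eps0; have [mEm muEm minEm] := hEm; have [mg _] := hg_loc.
have /andP[a0 _] := halpha.
have pot0 E : 0 <= potential g E.
  by apply: integral_ge0 => x _; rewrite lee_fin.
have per0 E : 0 <= frac_perimeter alpha E.
  by apply: integral_ge0 => y _; apply: integral_ge0 => x _; exact: riesz_ge0.
have en0 E : 0 <= energy alpha g E by exact: adde_ge0.
(* An infinite minimum makes the hypothesis on [E] read [+oo < 1]. *)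
case eEm : (energy alpha g Em) (en0 Em) => [e0| |//] e00; last first.
  exists 1%R => // E _ _ _.
  by case: (energy alpha g E).
rewrite lee_fin in e00.
apply: contrapT => noW.
have /choice[E EP] k : exists E : set (Rn R n), [/\ E `<=` eball rad,
    measurable E, lebesgue E = m%:E,
    energy alpha g E <= (e0 + k.+1%:R^-1)%:E &
    (eps * m)%:E <= lebesgue (E `+` Em)].
  apply: contrapT => noE; apply: noW; exists (k.+1%:R^-1)%R; first by rewrite invr_gt0.
  move=> E EB mE muE EW; rewrite ltNge; apply/negP => epsN; apply: noE; exists E.
  split => //; first by rewrite muE.
    have := le_lt_trans (lee_abs _) EW; rewrite lteBlDr// => /ltW.
    by rewrite EFinD addeC.
  move: epsN; rewrite (Lnorm1_indicB _ mE mEm) muEm inver gt_eqF// lee_pdivlMr//.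
have C0 : (0 <= e0 + 1)%R by rewrite addr_ge0.
have perC k : frac_perimeter alpha (E k) <= (e0 + 1)%:E.
  have [_ _ _ + _] := EP k; move=> /(le_trans (leeDl _ (pot0 _)))/le_trans; apply.
  by rewrite lee_fin lerD2l invf_le1// ler1n.
(* The radii [2 ^ -(j + 1)] make the jumps of the extracted sequence summable. *)
have pow2 (j : nat) : (0 < (2 ^ j.+1)%:R^-1 :> R)%R.
  by rewrite invr_gt0 ltr0n expn_gt0.
have [bc bcP] := choice (fun j =>
  perimeter_totally_bounded hn a0 hrad C0 (pow2 j)).
have [phi phiP] := diagonal_pigeonhole (b := fun j => (bc j).1)
  (c := fun j k => (bc j).2 (E k)) (fun j k => (bcP j).1 (E k)).
pose F j := E (phi j); pose A := set_liminf F.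
have mF j : measurable (F j) by have [] := EP (phi j).
have fastF j : lebesgue (F j `+` F j.+1) <= ((2 ^ j.+1)%:R^-1)%:E.
  have [EB mE _ _ _] := EP (phi j); have [EB' mE' _ _ _] := EP (phi j.+1).
  apply: (bcP j).2 => //; [exact: perC | exact: perC | exact: (phiP j).2].
have mA : measurable A by exact: measurable_set_liminf.
have muA : lebesgue A = m%:E.
  by apply: measure_liminf_eq => // j; have [] := EP (phi j).
have enA : energy alpha g A <= e0%:E.
  apply/lee_addgt0Pr => d d0; apply: energy_liminf_le => //.
    exact: liminf_gap_null.
  near=> j; have [_ _ _ + _] := EP (phi j); move/le_trans; apply.
  rewrite -EFinD lee_fin lerD2l invf_ple ?posrE ?ltr0n//.
  apply: (@le_trans _ _ j%:R); last by rewrite ler_nat ltnW// ltnS (phiP j).1.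
  by near: j; exact: nbhs_infty_ger.
have minA : is_minimizer alpha g m A.
  split => //; apply/eqP; rewrite eq_le; apply/andP; split.
    by rewrite -minEm eEm.
  by apply: ereal_inf_lbound; exists A.
have [J Jsmall] := exp2_small (mulr_gt0 eps0 hm).
have [_ _ _ _] := EP (phi J); apply/negP; rewrite -ltNge.
apply: le_lt_trans (setY_triangle _ (mF J) mA mEm) _.
rewrite [X in _ + X](hEm_unique _ minA) adde0 setYC.
apply: le_lt_trans (measure_setY_liminf mF fastF J) _.
by rewrite lte_fin.
Unshelve. all: by end_near.
Qed.
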